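(* There exists a sequence $(v_n)_{n \in \mathbb{N}}$ of non-trivial words $v_n \in \mathbf{F}_2$ such that for every $n \in \mathbb{N}$ the word $v_n$ is a law for all nilpotent groups of size at most $n$, and $$|v_n| = O\left(\log(n)^{3/2}\right) \quad \text{as } n \to \infty.$$
   Context: $\mathbf{F}_2 = \langle a,b\rangle$ denotes the free group on two generators $a,b$. For $w \in \mathbf{F}_2$, $|w|$ denotes the minimal word length of $w$ when written in terms of $\{a,a^{-1},b,b^{-1}\}$; this is the length of $w$. The word $w$ is non-trivial if it is not the neutral element of $\mathbf{F}_2$. For a group $G$ and $g,h \in G$, $w(g,h) \in G$ denotes the evaluation of $w$ at $a\mapsto g$, $b \mapsto h$. The word $w$ is a law for $G$ if $w(g,h)=1$ for all $g,h \in G$. The notation $|v_n| = O(f(n))$ as $n \to \infty$ means that there are constants $C, n_0$ with $|v_n| \le C f(n)$ for all $n \geq n_0$. *)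

(* Defs.v *)
From HB Require Import structures.
From mathcomp Require Import all_boot all_fingroup.

Set Implicit Arguments.
Unset Strict Implicit.
Unset Printing Implicit Defensive.

Local Open Scope group_scope.

(* A letter is a pair (generator, sign): the letters a, a^-1, b, b^-1 are
   (false, false), (false, true), (true, false), (true, true). *)
Notation letter := (bool * bool)%type.

Definition linv (l : letter) : letter := (l.1, ~~ l.2).

Definition reduced (s : seq letter) : bool := sorted (fun x y => y != linv x) s.

(* The free group on a and b, realised as the set of reduced words; the group
   law is concatenation followed by free cancellation. *)
Record FG2 : Type := MkFG2 { FG2val :> seq letter; FG2valP : reduced FG2val }.
HB.instance Definition _ := [isSub for FG2val].
HB.instance Definition _ := [Choice of FG2 by <:].

Definition push (l : letter) (s : seq letter) : seq letter :=
  if s is x :: s' then if x == linv l then s' else l :: s else [:: l].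

Definition red_mul (u v : seq letter) : seq letter := foldr push v u.

Definition red_inv (u : seq letter) : seq letter := rev (map linv u).

Lemma linvK : involutive linv.
Proof. by case=> x y; rewrite /linv /= negbK. Qed.

Lemma reduced_behead x s : reduced (x :: s) -> reduced s.
Proof. exact: path_sorted. Qed.

Lemma push_reduced l s : reduced s -> reduced (push l s).
Proof.
case: s => [|x s] //= sP; case: ifP => [_|xl]; first exact: reduced_behead sP.
by rewrite /reduced /= xl.
Qed.

Lemma push_reducedE l s : reduced (l :: s) -> push l s = l :: s.
Proof. by case: s => [|x s] //= /andP[/negPf-> _]. Qed.

Lemma pushK l s : reduced s -> push (linv l) (push l s) = s.
Proof.
case: s => [|x s] /= sP; first by rewrite linvK eqxx.
case: eqP => [xl|_] /=; last by rewrite linvK eqxx.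
by rewrite -xl push_reducedE.
Qed.

Lemma pushKV l s : reduced s -> push l (push (linv l) s) = s.
Proof. by move=> sP; rewrite -{1}[l]linvK pushK. Qed.

Lemma red_mul_reduced u v : reduced v -> reduced (red_mul u v).
Proof. by move=> vP; elim: u => //= l u; apply: push_reduced. Qed.

Lemma red_mul_push l u v :
  reduced v -> red_mul (push l u) v = push l (red_mul u v).
Proof.
case: u => [|x u] //= vP; case: eqP => [->|//].
by rewrite pushKV ?red_mul_reduced.
Qed.

Lemma red_mulA u v w :
  reduced w -> red_mul u (red_mul v w) = red_mul (red_mul u v) w.
Proof. by move=> wP; elim: u => //= l u ->; rewrite red_mul_push. Qed.

Lemma red_mulu0 u : reduced u -> red_mul u [::] = u.
Proof.
elim: u => //= l u IH uP.
by rewrite IH ?(reduced_behead uP) ?push_reducedE.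
Qed.

Lemma red_invK : involutive red_inv.
Proof. by move=> u; rewrite /red_inv map_rev revK (mapK linvK). Qed.

Lemma red_inv_reduced u : reduced u -> reduced (red_inv u).
Proof.
rewrite /reduced /red_inv rev_sorted sorted_map.
apply: sub_sorted => x y /=; apply: contraNN => /eqP xy.
by rewrite xy linvK.
Qed.

Lemma red_mulVu u v : reduced v -> red_mul (red_inv u) (red_mul u v) = v.
Proof.
elim: u v => //= l u IH v vP.
rewrite /red_mul /red_inv /= rev_cons foldr_rcons pushK ?red_mul_reduced //.
exact: IH.
Qed.

Definition FG2one : FG2 := @MkFG2 [::] isT.
Definition FG2mul (u v : FG2) : FG2 := MkFG2 (red_mul_reduced u (FG2valP v)).
Definition FG2inv (u : FG2) : FG2 := MkFG2 (red_inv_reduced (FG2valP u)).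

Lemma FG2mulA : associative FG2mul.
Proof. by move=> u v w; apply/val_inj/red_mulA/FG2valP. Qed.

Lemma FG2mul1g : left_id FG2one FG2mul.
Proof. by move=> u; apply: val_inj. Qed.

Lemma FG2mulg1 : right_id FG2one FG2mul.
Proof. by move=> u; apply/val_inj/red_mulu0/FG2valP. Qed.

Lemma FG2mulVg : left_inverse FG2one FG2inv FG2mul.
Proof.
move=> u; apply: val_inj => /=.
by rewrite -{2}(red_mulu0 (FG2valP u)) red_mulVu.
Qed.

Lemma FG2mulgV : right_inverse FG2one FG2inv FG2mul.
Proof.
by move=> u; rewrite -{1}(_ : FG2inv (FG2inv u) = u) ?FG2mulVg //;
  apply/val_inj/red_invK.
Qed.

HB.instance Definition _ :=
  isGroup.Build FG2 FG2mulA FG2mul1g FG2mulg1 FG2mulVg FG2mulgV.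

Definition FG2a : FG2 := @MkFG2 [:: (false, false)] isT.
Definition FG2b : FG2 := @MkFG2 [:: (true, false)] isT.

Definition letter_eval (G : groupType) (g h : G) (l : letter) : G :=
  let x := if l.1 then h else g in if l.2 then x^-1 else x.

Definition FG2eval (G : groupType) (g h : G) (w : FG2) : G :=
  \prod_(l <- w) letter_eval g h l.

(* FG2eval g h is the unique group morphism mapping a to g and b to h. *)
Section FG2evalTheory.
Variables (G : groupType) (g h : G).

Lemma letter_eval_linv l : letter_eval g h (linv l) = (letter_eval g h l)^-1.
Proof. by case: l => [x []]; rewrite /letter_eval //= invgK. Qed.

Lemma prod_push l s : \prod_(x <- push l s) letter_eval g h x =
  letter_eval g h l * \prod_(x <- s) letter_eval g h x.
Proof.
case: s => [|x s] /=; first by rewrite big_seq1 big_nil mulg1.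
case: eqP => [->|_]; last by rewrite big_cons.
by rewrite big_cons letter_eval_linv mulKVg.
Qed.

Lemma FG2evalM : {morph FG2eval g h : u v / u * v}.
Proof.
move=> u v; rewrite /FG2eval /=; elim: (FG2val u) => [|l s IH] /=.
  by rewrite big_nil mul1g.
by rewrite prod_push IH big_cons mulgA.
Qed.

Lemma FG2eval1 : FG2eval g h 1 = 1.
Proof. exact: big_nil. Qed.

HB.instance Definition _ :=
  isMultiplicative.Build FG2 G (FG2eval g h) FG2evalM.
HB.instance Definition _ :=
  Multiplicative_isUMagmaMorphism.Build FG2 G (FG2eval g h) FG2eval1.

Lemma FG2eval_a : FG2eval g h FG2a = g.
Proof. exact: big_seq1. Qed.

Lemma FG2eval_b : FG2eval g h FG2b = h.
Proof. exact: big_seq1. Qed.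

End FG2evalTheory.

Lemma FG2eval_id (w : FG2) : FG2eval FG2a FG2b w = w.
Proof.
case: w => s sP; apply: val_inj; rewrite /FG2eval /=.
elim: s sP => [|l s IH] sP; first by rewrite big_nil.
rewrite big_cons /= IH ?(reduced_behead sP) //.
rewrite -[RHS]push_reducedE //.
by case: l {sP} => [[] []].
Qed.

Lemma FG2eval_unique (G : groupType) (f : {multiplicative FG2 -> G}) (w : FG2) :
  f w = FG2eval (f FG2a) (f FG2b) w.
Proof.
have f1 : f 1 = 1 by apply: (mulgI (f 1)); rewrite -gmulfM !mulg1.
have fV u : f u^-1 = (f u)^-1.
  by apply: (mulgI (f u)); rewrite -gmulfM !mulgV.
rewrite -{1}(FG2eval_id w) /FG2eval (big_morph f (@gmulfM _ _ f) f1).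
by apply: eq_bigr => -[[] []] _; rewrite /letter_eval //= fV.
Qed.

Definition FG2spelled (w : FG2) (k : nat) : bool :=
  [exists s : k.-tuple letter, \prod_(l <- s) letter_eval FG2a FG2b l == w].

Lemma FG2spelled_ex (w : FG2) : exists k, FG2spelled w k.
Proof.
exists (size w); apply/existsP; exists (in_tuple w).
exact/eqP/FG2eval_id.
Qed.

(* The word length |w|: the least k such that w is a product of k letters. *)
Definition FG2length (w : FG2) : nat := ex_minn (FG2spelled_ex w).

Lemma size_push l s : size (push l s) <= (size s).+1.
Proof. by case: s => [|x s] //=; case: ifP => _ //; apply: leqW. Qed.

Lemma letter_mulE l (u : FG2) :
  FG2val (letter_eval FG2a FG2b l * u) = push l (FG2val u).
Proof. by case: l => -[] []. Qed.

Lemma size_prod_letters (s : seq letter) :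
  size (FG2val (\prod_(l <- s) letter_eval FG2a FG2b l)) <= size s.
Proof.
elim: s => [|l s IH]; first by rewrite big_nil.
rewrite big_cons letter_mulE.
by apply: leq_trans (size_push _ _) _; rewrite ltnS.
Qed.

Lemma FG2lengthE (w : FG2) : FG2length w = size w.
Proof.
rewrite /FG2length; case: ex_minnP => k /existsP[s /eqP sw] kmin.
apply/eqP; rewrite eqn_leq; apply/andP; split.
  by apply: kmin; apply/existsP; exists (in_tuple w); apply/eqP/FG2eval_id.
by rewrite -sw -{2}(size_tuple s); apply: size_prod_letters.
Qed.

Definition is_law (gT : finGroupType) (G : {group gT}) (w : FG2) : Prop :=
  forall g h : gT, g \in G -> h \in G -> FG2eval g h w = 1.

(* Main.v *)
Require Import Defs.
From mathcomp Require Import all_boot all_order all_algebra.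
From mathcomp Require Import all_fingroup all_solvable.
From mathcomp Require Import all_classical all_reals all_analysis.
From mathcomp Require Import zify ring.

(** A nilpotent group of order at most [n] has class at most [log2 n], because
    each proper step of its lower central series at least halves the order.
    So it suffices to find, for every [k], a short non-trivial word all of whose
    values lie in the [k]-th term [L_k] of the lower central series.

    Let [phi] be the endomorphism of the free group with
    [phi a = a b^-1] and [phi b = b^-1 a].  Put [x_n = phi^n a] and
    [y_n = phi^n b], so that [x_(n+1) = x_n y_n^-1] and
    [y_(n+1) = y_n^-1 x_n].  Two facts make the words [x_n] work.

    - There is no cancellation: in [phi w] every letter of the reduced word [w]
      becomes two letters, and the result is again reduced
      ([reduced_double_seq]).  Hence [x_n] has length exactly [2 ^ n], and in
      particular is non-trivial.

    - Since [y_(n+1) = x_n^-1 x_(n+1) x_n], the word [x_(n+2)], which is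
      [x_(n+1) y_(n+1)^-1], is a commutator of [x_(n+1)^-1] and [x_n].  As
      [[L_i, L_j]] is contained in [L_(i+j)] ([commg_lcn]), the depth of [x_n]
      in the lower central series grows at least like the Fibonacci numbers.

    Three Fibonacci steps multiply the depth by at least 4 (from depths [k] and
    [2k] one reaches [3k], [5k], [8k]) and the length by 8.  So depth [4 ^ j] is
    reached by a word of length [2 * 8 ^ j], and [8 = 4 `^ (3 / 2)] yields the
    exponent: depth [k] costs length [O(k `^ (3 / 2))], and a depth [k] of the
    order of [log n] is enough. *)

Set Implicit Arguments.
Unset Strict Implicit.
Unset Printing Implicit Defensive.

Import Order.TTheory GRing.Theory Num.Theory.

Local Open Scope group_scope.

(** * The cancellation-free endomorphism of the free group *)

(** The first letter of the image of [l] under [a |-> a b^-1], [b |-> b^-1 a].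
    The last letter is then the inverse of the first letter of the image of
    [l^-1], so this permutation of the letters encodes the endomorphism. *)
Definition double_head (l : letter) : letter := (l.1 (+) l.2, l.1).

Fixpoint double_seq (s : seq letter) : seq letter :=
  if s is l :: s' then
    [:: double_head l, linv (double_head (linv l)) & double_seq s']
  else [::].

Lemma double_head_inj : injective double_head.
Proof. by case=> [[] []] [[] []]. Qed.

Lemma linv_neq l : linv l != l.
Proof. by case: l => [[] []]. Qed.

Lemma size_double_seq s : size (double_seq s) = (2 * size s)%N.
Proof. by elim: s => //= l s ->; rewrite mulnS. Qed.

(** The image of [l] ends with the inverse of the head of the image of [l^-1],
    and [double_head] is injective: two consecutive images cancel only if the
    second letter is [l^-1]. *)
Lemma reduced_double_seq s : reduced s -> reduced (double_seq s).
Proof.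
elim: s => [|l s IH] //= sP.
have neq2 : linv (double_head (linv l)) != linv (double_head l).
  by rewrite (inj_eq (inv_inj linvK)) (inj_eq double_head_inj) linv_neq.
have := IH (reduced_behead sP); rewrite /reduced /= neq2 /=.
case: s sP {IH} => [|m s] //= /andP[ml _].
by rewrite linvK (inj_eq double_head_inj) ml.
Qed.

Definition double_word (w : FG2) : FG2 := MkFG2 (reduced_double_seq (FG2valP w)).

Lemma FG2eval_double (G : groupType) (g h : G) (w : FG2) :
  FG2eval g h (double_word w) = FG2eval (g * h^-1) (h^-1 * g) w.
Proof.
rewrite /FG2eval /=; elim: (FG2val w) => [|l s IH] /=.
  by rewrite !big_nil.
rewrite !big_cons IH mulgA; congr (_ * _).
by case: l => [[] []]; rewrite /letter_eval /= ?invgM ?invgK.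
Qed.

Definition lcs_word (n : nat) : FG2 := iter n double_word FG2a.

Lemma FG2length_lcs_word n : FG2length (lcs_word n) = (2 ^ n)%N.
Proof.
rewrite FG2lengthE; elim: n => //= n IH.
by rewrite size_double_seq IH expnS.
Qed.

Lemma lcs_word_neq1 n : lcs_word n <> 1.
Proof.
move=> w1; have := FG2length_lcs_word n.
by rewrite w1 FG2lengthE /=; case: (2 ^ n)%N (expn_gt0 2 n).
Qed.

(** [(x, y) |-> (x y^-1, y^-1 x)]: the substitution [double_word], seen on
    the pair of values of the two generators. *)
Definition twist (G : groupType) (p : G * G) : G * G :=
  (p.1 * p.2^-1, p.2^-1 * p.1).

Lemma FG2eval_lcs_word (G : groupType) n (g h : G) :
  FG2eval g h (lcs_word n) = (iter n (@twist G) (g, h)).1.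
Proof.
elim: n g h => [|n IH] g h; first exact: FG2eval_a.
by rewrite iterSr -IH; apply: FG2eval_double.
Qed.

(** The identity behind the construction: both components of [twist p] are
    conjugate by [p.1], so the next quotient is a commutator. *)
Lemma twist_commg (G : groupType) (p : G * G) :
  (twist (twist p)).1 = [~ (twist p).1^-1, p.1].
Proof.
by case: p => x y; rewrite /twist /commg /conjg /= !invgM !invgK !mulgA mulgKV.
Qed.

(** * The lower central series *)

(** The three subgroups lemma in the quotient by [N]; the induction of
    [commg_lcnS] uses it with [N] a term of the lower central series. *)
Lemma three_subgroup_mod (gT : finGroupType) (G H K N : {group gT}) :
    G \subset 'N(N) -> H \subset 'N(N) -> K \subset 'N(N) ->
    [~: G, H, K] \subset N -> [~: H, K, G] \subset N ->
  [~: K, G, H] \subset N.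
Proof.
have norm3 (A B C : {group gT}) : A \subset 'N(N) -> B \subset 'N(N) ->
    C \subset 'N(N) ->
    ([~: A, B, C] \subset N) = ([~: A / N, B / N, C / N] == 1).
  move=> nA nB nC; have nAB : [~: A, B] \subset 'N(N).
    by rewrite comm_subG.
  have nABC : [~: A, B, C] \subset 'N(N) by rewrite comm_subG.
  by rewrite -quotient_sub1 // !quotientR // subG1.
move=> nG nH nK; rewrite !norm3 // => /eqP GHK /eqP HKG.
by apply/eqP; apply: three_subgroup.
Qed.

(** By induction on [j]: ['L_j.+2(G)] is the commutator of ['L_j.+1(G)] and [G],
    so the three subgroups lemma moves [G] out, onto factors of smaller [j].
    Indices are shifted by one because ['L_n(G)] starts at ['L_1(G) = G]. *)
Lemma commg_lcnS (gT : finGroupType) (G : {group gT}) i j :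
  [~: 'L_i.+1(G), 'L_j.+1(G)] \subset 'L_(i + j).+2(G).
Proof.
elim: j i => [|j IH] i; first by rewrite addn0.
rewrite commGC (lcnSn j).
apply: (@three_subgroup_mod _ G ('L_i.+1(G))%G ('L_j.+1(G))%G
          ('L_(i + j.+1).+2(G))%G); rewrite ?lcn_norm //.
- by rewrite (fintype.subset_trans (lcn_sub _ _)) ?lcn_norm.
- by rewrite (fintype.subset_trans (lcn_sub _ _)) ?lcn_norm.
- by rewrite [X in [~: X, _]]commGC -lcnSn addnS -addSn IH.
- by rewrite /= addnS (lcnSn (i + j).+1) commSg ?IH.
Qed.

Lemma commg_lcn (gT : finGroupType) (G : {group gT}) i j :
  (0 < i)%N -> (0 < j)%N -> [~: 'L_i(G), 'L_j(G)] \subset 'L_(i + j)(G).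
Proof.
by case: i j => [|i] [|j] // _ _; rewrite addSn addnS commg_lcnS.
Qed.

Lemma mem_commg_lcn (gT : finGroupType) (G : {group gT}) i j k x y :
    (0 < i)%N -> (0 < j)%N -> (k <= i + j)%N ->
  x \in 'L_i(G) -> y \in 'L_j(G) -> [~ x^-1, y] \in 'L_k(G).
Proof.
move=> i0 j0 kij xL yL; apply: fintype.subsetP (lcn_sub_leq G kij) _ _.
by apply: fintype.subsetP (commg_lcn G i0 j0) _ _; rewrite mem_commg ?groupV.
Qed.

(** The second membership is carried along because each term is a commutator
    of the two preceding ones. *)
Lemma twist_lcn (gT : finGroupType) (G : {group gT}) (g h : gT) j :
    g \in G -> h \in G ->
  (iter (3 * j).+1 (@twist gT) (g, h)).1 \in 'L_(4 ^ j)(G) /\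
  (iter (3 * j).+2 (@twist gT) (g, h)).1 \in 'L_(2 * 4 ^ j)(G).
Proof.
move=> gG hG.
pose x n := (iter n (@twist gT) (g, h)).1.
rewrite -![(iter _ _ _).1]/(x _).
have xSS n : x n.+2 = [~ (x n.+1)^-1, x n] by apply: twist_commg.
elim: j => [|j [xL yL]].
  have x1G : x 1%N \in G by rewrite groupM ?groupV.
  by split=> //; rewrite muln0 xSS mem_commg ?groupV.
have k_gt0 : (0 < 4 ^ j)%N by rewrite expn_gt0.
rewrite mulnS !addSn add0n expnS.
move: (4 ^ j)%N (3 * j)%N k_gt0 xL yL => k m k0 xL yL.
have x3 : x m.+3 \in 'L_(3 * k)(G).
  by rewrite xSS; apply: mem_commg_lcn yL xL; lia.
have x4 : x m.+4 \in 'L_(5 * k)(G).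
  by rewrite xSS; apply: mem_commg_lcn x3 yL; lia.
split; last by rewrite xSS; apply: mem_commg_lcn x4 x3; lia.
by apply: fintype.subsetP (lcn_sub_leq G _) _ x4; lia.
Qed.

(** By nilpotency a non-trivial term properly contains the next one, so the
    index of each step is at least 2. *)
Lemma lcn_halving (gT : finGroupType) (G : {group gT}) k :
  nilpotent G -> 'L_k.+1(G) = 1 \/ (2 ^ k * #|'L_k.+1(G)| <= #|G|)%N.
Proof.
move=> nilG; elim: k => [|k [L1|IH]]; first by right; rewrite mul1n.
  by left; apply/trivgP; rewrite -L1 lcn_subS.
have [L1|ntL] := eqVneq 'L_k.+1(G) 1.
  by left; apply/trivgP; rewrite -L1 lcn_subS.
right; apply: leq_trans IH; rewrite expnS [(2 * _)%N]mulnC -mulnA leq_mul2l.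
have prL : 'L_k.+2(G) \proper 'L_k.+1(G).
  rewrite lcnSn; apply: nil_comm_properl nilG _ ntL _.
  - exact: lcn_sub.
  - by rewrite finset.subsetI subxx lcn_norm.
rewrite -(Lagrange (proper_sub prL)) mulnC leq_mul2l.
by rewrite [X in _ || (_ || X)]indexg_gt1 proper_subn ?orbT.
Qed.

Lemma lcn_eq1 (gT : finGroupType) (G : {group gT}) k :
  nilpotent G -> (#|G| < 2 ^ k)%N -> 'L_k.+1(G) = 1.
Proof.
move=> nilG ltG; have [//|leG] := lcn_halving k nilG.
have L0 := cardG_gt0 ('L_k.+1(G))%G.
by have := leq_ltn_trans leG ltG; rewrite ltnNge leq_pmulr.
Qed.

(** Depth [4 ^ j] lies beyond the class of [G], which is at most [k]. *)
Lemma lcs_word_law (gT : finGroupType) (G : {group gT}) k j :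
    nilpotent G -> (#|G| < 2 ^ k)%N -> (k < 4 ^ j)%N ->
  is_law G (lcs_word (3 * j).+1).
Proof.
move=> nilG ltG ltk g h gG hG; rewrite FG2eval_lcs_word.
have [xL _] := twist_lcn j gG hG.
by apply/set1P; rewrite -set1gE -(lcn_eq1 nilG ltG);
  apply: fintype.subsetP (lcn_sub_leq G ltk) _ xL.
Qed.

Local Open Scope ring_scope.

(** * The length estimate *)

(** Counts triples of doublings: the least [j] for which [4 ^ j] is at least
    [trunc_log 2 n + 2], a depth at which the lower central series of every
    nilpotent group of order at most [n] is trivial. *)
Definition depth_log (n : nat) : nat := up_log 4 (trunc_log 2 n).+2.

(** The factor 4 is the rounding loss of [up_log], and [t + 2 <= 3 t] for
    [t = trunc_log 2 n], which is positive once [n >= 2]. *)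
Lemma depth_log_bound (n : nat) :
  (2 <= n)%N -> (4 ^ depth_log n <= 12 * trunc_log 2 n)%N.
Proof.
move=> n2; rewrite /depth_log; set t := trunc_log 2 n.
have t0 : (0 < t)%N by rewrite /t trunc_log_gt0.
have /andP[] := @up_log_bounds 4 t.+2 isT isT.
case: (up_log 4 t.+2) => [|m] /=; first by lia.
by rewrite expnS; lia.
Qed.

Lemma trunc_log_ln (R : realType) (n : nat) :
  (0 < n)%N -> (trunc_log 2 n)%:R * ln 2 <= ln n%:R :> R.
Proof.
move=> n0; rewrite mulr_natl -lnXn ?ltr0n // ler_ln ?posrE ?exprn_gt0 ?ltr0n //.
by rewrite -natrX ler_nat trunc_logP.
Qed.

Lemma powR_4_32 (R : realType) (j : nat) :
  (4 ^ j)%:R `^ (3 / 2) = (8 ^ j)%:R :> R.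
Proof.
have -> : (4 ^ j)%:R = 2%:R `^ (2 * j%:R) :> R.
  by rewrite -natrM powR_mulrn // -natrX expnM.
rewrite -powRrM (_ : 2 * j%:R * (3 / 2) = (3 * j)%:R); last first.
  by rewrite natrM; field.
by rewrite powR_mulrn // -natrX expnM.
Qed.

Theorem proposition3p1 (R : realType) :
  exists v : nat -> FG2,
    (forall n : nat, v n <> 1%g) /\
    (forall (n : nat) (gT : finGroupType) (G : {group gT}),
        nilpotent G -> (#|G| <= n)%N -> is_law G (v n)) /\
    (exists (C : R) (n0 : nat), forall n : nat, (n0 <= n)%N ->
        (FG2length (v n))%:R <= C * (ln n%:R) `^ (3 / 2)).
Proof.
exists (fun n => lcs_word (3 * depth_log n).+1); split; [|split].
- by move=> n; apply: lcs_word_neq1.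
- move=> n gT G nilG leG; apply: (lcs_word_law (k := (trunc_log 2 n).+1)) => //.
    by apply: leq_ltn_trans leG _; apply: trunc_log_ltn.
  exact: up_logP.
have ln2 : 0 < ln 2 :> R by rewrite ln_gt0 // ltr1n.
exists (2 * (12 / ln 2) `^ (3 / 2)), 2%N => n n2.
have lnn : 0 <= ln n%:R :> R by rewrite ln_ge0 // ler1n; lia.
have K_ge0 : 0 <= 12 / ln 2 :> R by rewrite divr_ge0 // ltW.
rewrite FG2length_lcs_word expnS expnM natrM -mulrA ler_wpM2l //.
rewrite -powR_4_32 -powRM //.
have Kln_ge0 := mulr_ge0 K_ge0 lnn.
apply: ge0_ler_powR; rewrite ?nnegrE ?divr_ge0 //.
apply: (@le_trans _ _ (12 * trunc_log 2 n)%:R).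
  by rewrite ler_nat depth_log_bound.
rewrite natrM -mulrA ler_wpM2l // mulrC ler_pdivlMr //.
by apply: trunc_log_ln; lia.
Qed.
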